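(* Let $b\in\mathbb{R}$. For each nonnegative integer $n$ define the polynomial in $x$ $$H_n(b,x)=\det\left(\binom{x+i+j}{2j}+b\binom{x+i+j}{2j+1}\right)_{i,j=0}^{n-1},$$ with $H_0(b,x)=1$, and let $$M_b(n)=\sum_{k=0}^{n}\left(\binom{n+k}{k}-\binom{n+k}{k-1}\right)b^{n-k}.$$ Then $H_n(b,1)=M_b(n)$ for all $n\ge 0$, and for every nonnegative integer $n$ and every positive integer $k$, $$H_n(b,k)=\det\left(H_{n+i+j}(b,1)\right)_{i,j=0}^{k-1}=\det\left(M_b(n+i+j)\right)_{i,j=0}^{k-1}.$$
   Context: For a polynomial variable $y$ and integer $m\ge 0$, $\binom{y}{m}=\frac{y(y-1)\cdots(y-m+1)}{m!}$, and $\binom{y}{-1}=0$. The determinant of a $0\times 0$ matrix is $1$. *)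

(* Defs.v *)
From HB Require Import structures.
From mathcomp Require Import all_boot all_order all_algebra.
From mathcomp Require Import reals.

Set Implicit Arguments.
Unset Strict Implicit.
Unset Printing Implicit Defensive.

Import Order.TTheory GRing.Theory Num.Theory.
Local Open Scope ring_scope.

(* The polynomial binom(y, m) in the variable y = 'X. The lower index is an
   int so that binom(y, -1) = 0 is literal; negative indices all give 0. *)
Definition binpoly (R : realType) (m : int) : {poly R} :=
  match m with
  | Posz p => (p`!%:R)^-1 *: \prod_(i < p) ('X - i%:R%:P)
  | Negz _ => 0
  end.

(* Entry (i, j) is binom(x+i+j, 2j) + b binom(x+i+j, 2j+1), with x = 'X. *)
Definition Hmx (R : realType) (b : R) (n : nat) : 'M[{poly R}]_n :=
  \matrix_(i < n, j < n)
    (binpoly R (2 * j)%N%:Z \Po ('X + (i + j)%N%:R%:P)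
     + b *: (binpoly R (2 * j + 1)%N%:Z \Po ('X + (i + j)%N%:R%:P))).

Definition H (R : realType) (n : nat) (b : R) : {poly R} := \det (Hmx b n).

Definition M (R : realType) (b : R) (n : nat) : R :=
  \sum_(0 <= k < n.+1)
    ((binpoly R k%:Z).[(n + k)%N%:R] - (binpoly R (k%:Z - 1)).[(n + k)%N%:R])
    * b ^+ (n - k).

Lemma H0E (R : realType) (b : R) : H 0 b = 1.
Proof. exact: det_mx00. Qed.

(* Main.v *)
Require Import Defs.
From HB Require Import structures.
From mathcomp Require Import all_boot all_order all_algebra.
From mathcomp Require Import reals ring zify.

Set Implicit Arguments.
Unset Strict Implicit.
Unset Printing Implicit Defensive.

Import Order.TTheory GRing.Theory Num.Theory.
Local Open Scope ring_scope.

(** The [M b n] are the moments of a linear functional whose monic orthogonal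
    polynomials are
    [p_i(x) = \sum_l (-1)^(i+l) (C(i+l, 2l) + b C(i+l, 2l+1)) x^l],
    all of norm 1; up to signs, the matrix defining [H n b] at [x = k] is the
    matrix of the coefficients of [x^0 .. x^(n-1)] in [p_k .. p_(k+n-1)].
    Christoffel's formula then equates the two determinants: multiply the matrix
    of all the coefficients of [p_0 .. p_(n+k-1)] by the matrix whose first [k]
    columns are those of the Hankel matrix of moments and whose last [n] columns
    are the first [n] vectors of the standard basis.  By orthogonality the
    first [k] columns of the product are upper unitriangular. *)

(** * Determinants with entries indexed by natural numbers *)

Section DetNat.
Variable R : comNzRingType.
Implicit Types (f g : nat -> nat -> R) (u v : nat -> R).

(** Indexing by [nat] instead of ordinals lets shifts and block splittings go without casts. *)
Definition detn n f := \det (\matrix_(i < n, j < n) f i j).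

Lemma eq_detn n f g :
  (forall i j, (i < n)%N -> (j < n)%N -> f i j = g i j) -> detn n f = detn n g.
Proof. by move=> fg; congr (\det _); apply/matrixP => i j; rewrite !mxE fg. Qed.

Lemma detn_mul n f g :
  detn n f * detn n g = detn n (fun i j => \sum_(l < n) f i l * g l j).
Proof.
rewrite -det_mulmx; congr (\det _); apply/matrixP => i j; rewrite !mxE.
by apply: eq_bigr => l _; rewrite !mxE.
Qed.

Lemma detn_scale n u v f :
  detn n (fun i j => u i * v j * f i j) =
  (\prod_(i < n) u i) * (\prod_(i < n) v i) * detn n f.
Proof.
transitivity (\det (diag_mx (\row_(i < n) u i) *m (\matrix_(i < n, j < n) f i j)
   *m diag_mx (\row_(i < n) v i))).
  congr (\det _); apply/matrixP => i j.
  by rewrite mul_mx_diag mxE mul_diag_mx !mxE; ring.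
rewrite !det_mulmx !det_diag mulrAC; congr (_ * _ * _).
  by apply: eq_bigr => i _; rewrite !mxE.
by apply: eq_bigr => i _; rewrite !mxE.
Qed.

Lemma detn_col_delta n c f : (c < n.+1)%N ->
  (forall i, (i < n.+1)%N -> f i c = (i == 0%N)%:R) ->
  detn n.+1 f = (-1) ^+ c * detn n (fun i j => f i.+1 (bump c j)).
Proof.
move=> lc fc; rewrite /detn (expand_det_col _ (Ordinal lc)) big_ord_recl big1.
  rewrite addr0 !mxE fc //= mul1r /cofactor /= add0n; congr (_ * \det _).
  by apply/matrixP => i j; rewrite !mxE.
by move=> i _; rewrite !mxE fc ?ltn_ord //= mul0r.
Qed.

Lemma detn_ublock_unitrig k n f :
  (forall i, (i < k)%N -> f i i = 1) ->
  (forall i j, (j < k)%N -> (j < i)%N -> (i < k + n)%N -> f i j = 0) ->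
  detn (k + n) f = detn n (fun i j => f (k + i)%N (k + j)%N).
Proof.
elim: k f => [|k IH] f f1 f0; first exact: eq_detn.
rewrite (@detn_col_delta (k + n) 0) //; last first.
  by case=> [|i] li; rewrite ?f1 ?f0.
rewrite expr0 mul1r IH => [|i lk|i j *]; [exact: eq_detn | exact: f1 |].
by apply: f0; rewrite ?addSn ltnS.
Qed.

(** Expansion along column [k], repeated [n] times: each step removes row 0 and one basis vector,
    keeps the shape, and costs a sign [(-1) ^+ k]. *)
Lemma detn_antidiag_block n k f :
  (forall i j, (i < n + k)%N -> (j < n)%N -> f i (k + j)%N = (i == j)%:R) ->
  detn (n + k) f = (-1) ^+ (n * k) * detn k (fun i j => f (n + i)%N j).
Proof.
elim: n f => [|n IH] f fd.
  by rewrite mul0n expr0 mul1r; apply: eq_detn.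
rewrite (@detn_col_delta (n + k) k) ?ltnS ?leq_addl //; last first.
  by move=> i li; rewrite -[X in f _ X]addn0 fd.
rewrite IH => [|i j li lj]; last first.
  by rewrite /bump leq_addr add1n -addnS fd.
rewrite mulrA -exprD -mulSn; congr (_ * _); apply: eq_detn => i j _ lj.
by rewrite /bump leqNgt lj.
Qed.

End DetNat.

Section Moments.
Variable R : realType.
Variable b : R.

(** * Coefficients of the polynomials and their recurrence *)

Lemma binpoly_nat (p m : nat) : (binpoly R p).[m%:R] = 'C(m, p)%:R.
Proof.
rewrite /= hornerZ horner_prod.
under eq_bigr do rewrite hornerXsubC.
have -> : \prod_(i < p) (m%:R - (i : nat)%:R : R) = (m ^_ p)%:R.
  case: (leqP p m) => [le_pm|lt_mp].
    rewrite ffact_prod natr_prod; apply: eq_bigr => i _.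
    by rewrite natrB // (leq_trans _ le_pm) // ltnW.
  by rewrite ffact_small // (bigD1 (Ordinal lt_mp)) //= subrr mul0r.
rewrite -bin_ffact natrM mulrC mulfK //.
by rewrite pnatr_eq0 -lt0n fact_gt0.
Qed.

(** In the matrix of [H n b], [x] and the row index enter only through their sum, here [i]. *)
Definition hcoef (i l : nat) : R :=
  'C(i + l, 2 * l)%:R + b * 'C(i + l, 2 * l + 1)%:R.

Lemma horner_H n k : (H n b).[k%:R] = detn n (fun i j => hcoef (k + i) j).
Proof.
rewrite /H -[LHS]/(horner_eval k%:R _) -det_map_mx; congr (\det _).
apply/matrixP => i j; rewrite !mxE /= /horner_eval hornerD hornerZ !horner_comp.
rewrite !hornerD !hornerX !hornerC -!natrD.
by rewrite !binpoly_nat addnA.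
Qed.

Lemma hcoefS0 i : hcoef i.+2 0 = hcoef i.+1 0 *+ 2 - hcoef i 0.
Proof.
by rewrite /hcoef !addn0 muln0 !bin0 add0n !bin1 -!natr1; ring.
Qed.

Lemma binSS m r :
  'C(m.+2, r.+2) = ('C(m, r.+2) + 'C(m, r.+1) + 'C(m, r.+1) + 'C(m, r))%N.
Proof. by rewrite !binS; lia. Qed.

Lemma hcoefSS i l :
  hcoef i.+2 l.+1 = hcoef i.+1 l + hcoef i.+1 l.+1 *+ 2 - hcoef i l.+1.
Proof.
rewrite /hcoef !addn1.
have -> : (i.+2 + l.+1 = (i + l).+3)%N by lia.
have -> : (i.+1 + l.+1 = (i + l).+2)%N by lia.
have -> : (i + l.+1 = (i + l).+1)%N by lia.
have -> : (i.+1 + l = (i + l).+1)%N by lia.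
have -> : (2 * l.+1 = (2 * l).+2)%N by lia.
move: (i + l)%N (2 * l)%N => m r.
rewrite !(binSS m.+1) !(binS m.+1 _.+1) !natrD; ring.
Qed.

Lemma hcoef_diag i : hcoef i i = 1.
Proof.
by rewrite /hcoef addnn -mul2n binn bin_small ?addn1 // mulr0 addr0.
Qed.

Lemma hcoef_small i l : (i < l)%N -> hcoef i l = 0.
Proof. by move=> il; rewrite /hcoef !bin_small ?mulr0 ?addr0 //; lia. Qed.

Definition pcoef (i l : nat) : R := (-1) ^+ i * (-1) ^+ l * hcoef i l.

Lemma pcoef_diag i : pcoef i i = 1.
Proof.
by rewrite /pcoef hcoef_diag -exprD addnn -mul2n exprM sqrrN !expr1n mulr1.
Qed.

Lemma pcoef_small i l : (i < l)%N -> pcoef i l = 0.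
Proof. by move=> il; rewrite /pcoef hcoef_small ?mulr0. Qed.

(** Together with [pcoefSS], this is [p_(i+2) = (x - 2) p_(i+1) - p_i] read coefficient by
    coefficient. *)
Lemma pcoefS0 i : pcoef i.+2 0 = - pcoef i.+1 0 *+ 2 - pcoef i 0.
Proof. by rewrite /pcoef hcoefS0 !exprS; ring. Qed.

Lemma pcoefSS i l :
  pcoef i.+2 l.+1 = pcoef i.+1 l - pcoef i.+1 l.+1 *+ 2 - pcoef i l.+1.
Proof. by rewrite /pcoef hcoefSS !exprS; ring. Qed.

(** * Mixed moments and orthogonality *)

Definition ballot j k i : R := 'C(j + k, j + i)%:R - 'C(j + k, j + i.+1)%:R.

(* The value of the moment functional at [x^j p_i(x)]. *)
Definition mixed_moment j i := \sum_(k < j.+1) ballot j k i * b ^+ (j - k).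

Lemma M_mixed_moment n : M b n = mixed_moment n 0.
Proof.
rewrite /M big_mkord; apply: eq_bigr => k _; congr (_ * _).
rewrite /ballot addn0 binpoly_nat -bin_sub ?leq_addl // addnK; congr (_ - _).
(* At [k = 0] the lower index -1 gives 0, as does the binomial of [n] over [n + 1]. *)
move: (k : nat) => {k} [|k]; first by rewrite /= horner0 addn0 addn1 bin_small.
rewrite (_ : k.+1%:Z - 1 = k%:Z); last by lia.
rewrite binpoly_nat -bin_sub; last by lia.
by congr ('C(_, _)%:R); lia.
Qed.

Lemma mixed_moment_diag j : mixed_moment j j = 1.
Proof.
rewrite /mixed_moment big_ord_recr /= big1 => [|k _].
  by rewrite add0r subnn mulr1 /ballot binn bin_small ?subr0 // addnS.
by rewrite /ballot !bin_small ?subrr ?mul0r //; have := ltn_ord k; lia.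
Qed.

Lemma mixed_moment_small j i : (j < i)%N -> mixed_moment j i = 0.
Proof.
move=> ji; rewrite /mixed_moment big1 // => k _.
by rewrite /ballot !bin_small ?subrr ?mul0r //; have := ltn_ord k; lia.
Qed.

(** The functional applied to [x^j] times [x p_(i+1) = p_i + 2 p_(i+1) + p_(i+2)]. The term [k = 0]
    vanishes; Pascal's rule, used twice, handles the others. *)
Lemma mixed_momentSS j i :
  mixed_moment j.+1 i.+1 =
  mixed_moment j i + mixed_moment j i.+1 *+ 2 + mixed_moment j i.+2.
Proof.
rewrite /mixed_moment big_ord_recl /= /ballot !bin_small; try by lia.
rewrite subrr mul0r add0r -sumrMnl -!big_split; apply: eq_bigr => k _ /=.
rewrite /bump leq0n add1n subSS.
rewrite !addSn !addnS.
rewrite !binSS !natrD; ring.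
Qed.

(** The boundary case [x p_0 = (1 + b) p_0 + p_1]. *)
Lemma mixed_momentS0 j :
  mixed_moment j.+1 0 = (1 + b) * mixed_moment j 0 + mixed_moment j 1.
Proof.
(* The factor [b] shifts [k] by one; the added last term is 0 by symmetry of the binomials of
   [2j + 1]. *)
have bE : b * mixed_moment j 0 =
    b ^+ j.+1 + \sum_(k < j.+1) ballot j k.+1 0 * b ^+ (j - k).
  rewrite big_ord_recr /= {2}/ballot.
  rewrite (_ : 'C(j + j.+1, j + 0) = 'C(j + j.+1, j + 1)); last first.
    by rewrite -bin_sub; [congr ('C(_, _)) | ]; lia.
  rewrite subrr mul0r addr0 /mixed_moment big_ord_recl /= mulrDr; congr (_ + _).
    by rewrite /ballot addn0 addn1 binn bin_small // subr0 mul1r subn0 exprS.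
  rewrite mulr_sumr; apply: eq_bigr => k _; rewrite /bump leq0n add1n.
  rewrite mulrCA -exprS; congr (_ * _ ^+ _).
  by have := ltn_ord k; lia.
rewrite mulrDl mul1r bE /mixed_moment big_ord_recl /=.
rewrite {1}/ballot !addn0 addn1 binn bin_small // subr0 mul1r subn0.
rewrite addrCA -!addrA; congr (_ + _).
rewrite [X in _ = X](_ : _ = \sum_(k < j.+1) (ballot j k 0 + ballot j k.+1 0
  + ballot j k 1) * b ^+ (j - k)); last first.
  by rewrite -!big_split; apply: eq_bigr => k _ /=; ring.
apply: eq_bigr => k _ /=.
rewrite /bump leq0n add1n subSS; congr (_ * _).
rewrite /ballot !addn0 !addn1 !addSn !addnS !addn0.
rewrite !binSS !binS !natrD; ring.
Qed.

(** Both sides obey the same recurrence in [i]. Any [N > i] is allowed, so that the induction can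
    use sums of different lengths. *)
Lemma sum_pcoef_M i j N : (i < N)%N ->
  \sum_(l < N) pcoef i l * M b (l + j) = mixed_moment j i.
Proof.
elim/ltn_ind: i j N => [[|[|i]]] IH j [//|N] ltiN.
- rewrite big_ord_recl big1 => [|l _]; last by rewrite pcoef_small ?mul0r.
  by rewrite pcoef_diag mul1r addr0 M_mixed_moment.
- case: N ltiN => // N _.
  rewrite !big_ord_recl big1 => [|l _]; last by rewrite pcoef_small ?mul0r.
  rewrite /= pcoef_diag mul1r addr0 !M_mixed_moment add0n add1n mixed_momentS0.
  by rewrite /pcoef /hcoef !addn0 muln0 add0n bin0 bin1; ring.
(* Multiplication by [x] raises the degree, hence [j.+1] with one term fewer. *)
have E1 := IH i.+1 (ltnSn _) j.+1 N ltiN.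
have E2 := IH i.+1 (ltnSn _) j N.+1 (leqW ltiN).
have E3 := IH i (leqW (ltnSn _)) j N.+1 (leqW (ltnW ltiN)).
have -> : mixed_moment j i.+2 = mixed_moment j.+1 i.+1
    - mixed_moment j i.+1 *+ 2 - mixed_moment j i.
  by rewrite mixed_momentSS; ring.
rewrite -E1 -E2 -E3 !big_ord_recl /= pcoefS0.
under eq_bigr => l _
  do rewrite /bump leq0n add1n pcoefSS !mulrDl !mulNr mulrnAl.
rewrite !big_split /= !sumrN sumrMnl.
under eq_bigr => l _ do rewrite addSnnS.
ring.
Qed.

(** * Comparison of the two determinants *)

Lemma detn_pcoef n : detn n pcoef = 1.
Proof.
rewrite /detn det_trig; last first.
  by apply/is_trig_mxP => i j ij; rewrite mxE pcoef_small.
by rewrite big1 // => i _; rewrite mxE pcoef_diag.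
Qed.

Lemma detn_pcoef_minor n k :
  detn n (fun i j => pcoef (k + i) j) =
  (-1) ^+ (n * k) * detn n (fun i j => hcoef (k + i) j).
Proof.
rewrite /pcoef (detn_scale n (fun i => (-1) ^+ (k + i)) (fun j => (-1) ^+ j)).
congr (_ * _); rewrite -big_split /=.
under eq_bigr => i _ do rewrite -exprD -addnA addnn exprD -mul2n exprM
  sqrrN !expr1n mulr1.
by rewrite prodr_const card_ord -exprM mulnC.
Qed.

Lemma detn_hcoef_Hankel n k :
  detn n (fun i j => hcoef (k + i) j) = detn k (fun i j => M b (n + i + j)).
Proof.
pose X i j : R := if (j < k)%N then M b (i + j) else (i == j - k)%N%:R.
have dX :
    detn (n + k) X = (-1) ^+ (n * k) * detn k (fun i j => M b (n + i + j)).
  rewrite detn_antidiag_block => [|i j _ _]; last first.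
    by rewrite /X ltnNge leq_addr /= addKn.
  by congr (_ * _); apply: eq_detn => i j _ lj; rewrite /X lj.
have :
    detn (n + k) pcoef * detn (n + k) X = detn n (fun i j => pcoef (k + i) j).
  rewrite detn_mul [in detn (n + k)]addnC detn_ublock_unitrig.
  (* The basis vectors in [X] select columns of [pcoef]. *)
  - apply: eq_detn => i j li lj.
    have lj' : (j < n + k)%N by lia.
    rewrite (bigD1 (Ordinal lj')) //= big1 => [|l].
      by rewrite /X ltnNge leq_addr /= addKn eqxx mulr1 addr0.
    rewrite -val_eqE /= => /negPf nlj.
    by rewrite /X ltnNge leq_addr /= addKn nlj mulr0.
  (* In the first [k] columns the entries of the product are mixed moments. *)
  - move=> i lik; rewrite -[RHS](mixed_moment_diag i).
    rewrite -(@sum_pcoef_M i i (n + k)); last by lia.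
    by apply: eq_bigr => l _; rewrite /X lik.
  - move=> i j ljk lji lik; rewrite -[RHS](mixed_moment_small lji).
    rewrite -(@sum_pcoef_M i j (n + k)); last by lia.
    by apply: eq_bigr => l _; rewrite /X ljk.
(* Both sides carry the same sign [(-1) ^+ (n * k)], which cancels. *)
rewrite detn_pcoef mul1r dX detn_pcoef_minor => /mulfI -> //.
by rewrite signr_eq0.
Qed.

End Moments.

Theorem theorem4 (R : realType) (b : R) :
  (forall n : nat, (H n b).[1] = M b n) /\
  (forall n k : nat, (0 < k)%N ->
     (H n b).[k%:R]
       = \det (\matrix_(i < k, j < k) (H (n + i + j)%N b).[1]) /\
     \det (\matrix_(i < k, j < k) (H (n + i + j)%N b).[1])
       = \det (\matrix_(i < k, j < k) M b (n + i + j)%N)).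
Proof.
have H1 n : (H n b).[1] = M b n.
  (* For [k = 1] the Hankel matrix has the single entry [M b n]. *)
  rewrite -[1]/(1%:R) horner_H detn_hcoef_Hankel /detn det_mx11 mxE.
  by rewrite !addn0.
split=> // n k _.
have -> : \matrix_(i < k, j < k) (H (n + i + j)%N b).[1]
  = \matrix_(i < k, j < k) M b (n + i + j)%N.
  by apply/matrixP => i j; rewrite !mxE H1.
by rewrite horner_H detn_hcoef_Hankel.
Qed.
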